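(* Let $X=(\mathbb{R}^2,\sup)$ be the plane with the sup metric, with bordification $\overline{X}=X\cup\partial_h(X)$ by its horofunction boundary. The stars of axial boundary points $h^{*}$ are closed hemispheres, while the stars of nonaxial boundary points $h^{*}_m$ are closed axial quadrants. Explicitly, for $P\in\{{\rm N},{\rm S}\}$ and $Q\in\{{\rm E},{\rm W}\}$ let $$\mathcal{Q}(P,Q)=\{h^{P},\,h^{PQ}_\ell,\,h^{QP}_\ell,\,h^{Q}\mid \ell\ge 0\}.$$ Then for all $P\in\{{\rm N},{\rm S}\}$, $Q\in\{{\rm E},{\rm W}\}$ and $m\ge 0$, $$\mathsf{S}(h^{P})=\mathcal{Q}(P,{\rm E})\cup\mathcal{Q}(P,{\rm W}),\qquad \mathsf{S}(h^{Q})=\mathcal{Q}({\rm N},Q)\cup\mathcal{Q}({\rm S},Q),$$ $$\mathsf{S}(h^{PQ}_m)=\mathsf{S}(h^{QP}_m)=\mathcal{Q}(P,Q).$$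
   Context: The sup metric is $d((x,y),(x',y'))=\max(|x-x'|,|y-y'|)$; the basepoint is $x_0=(0,0)$. Horofunction boundary: embed $X$ in the space $C(X)$ of continuous real functions (topology of uniform convergence on compact sets) by $\Psi(z)=d(z,\cdot)-d(z,x_0)$; then $\overline{X}$ is the closure $\overline{\Psi(X)}$ and $\partial_h(X)=\overline{\Psi(X)}\setminus\Psi(X)$. The points of $\partial_h(X)$ are the following functions of $(x,y)\in\mathbb{R}^2$, for $m\ge0$: the axial points $h^{\rm N}=-y$, $h^{\rm S}=y$, $h^{\rm E}=-x$, $h^{\rm W}=x$; and the nonaxial points $h^{\rm NE}_m=\max(-x-m,-y)$, $h^{\rm EN}_m=\max(-x,-y-m)$, $h^{\rm NW}_m=\max(x-m,-y)$, $h^{\rm WN}_m=\max(x,-y-m)$, $h^{\rm SE}_m=\max(-x-m,y)$, $h^{\rm ES}_m=\max(-x,y-m)$, $h^{\rm SW}_m=\max(x-m,y)$, $h^{\rm WS}_m=\max(x,y-m)$. Stars: for $W\subset X$ nonempty and $C\ge 0$, the halfspace is $H(W,C)=\{z\in X: d(z,W)\le d(z,x_0)+C\}$; for $V$ an open subset of $\overline{X}$, $H(V,C)$ means $H(V\cap X,C)$. For $\xi\in\partial_h (X)$ let $\mathcal{V}_\xi$ be the collection of open neighborhoods of $\xi$ in $\overline{X}$. The star of $\xi$ is $$\mathsf{S}(\xi)=\overline{\bigcup_{C\ge 0}\ \bigcap_{V\in\mathcal{V}_\xi}\overline{H(V,C)}},$$ with closures taken in $\overline{X}$. *)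

(* Defs.v *)
From HB Require Import structures.
From mathcomp Require Import all_boot all_order all_algebra.
From mathcomp Require Import all_classical all_reals all_analysis.
From mathcomp Require Import lra.

Set Implicit Arguments.
Unset Strict Implicit.
Unset Printing Implicit Defensive.

Import Order.TTheory GRing.Theory Num.Theory.
Import numFieldNormedType.Exports.
Local Open Scope classical_set_scope.
Local Open Scope ring_scope.

Definition dsup {R : realType} (z w : R * R) : R :=
  Num.max `|z.1 - w.1| `|z.2 - w.2|.

(* C(X), with the topology of uniform convergence on compact sets. *)
Definition contfun (R : realType) : Type := continuousType (R * R)%type R.

HB.instance Definition _ (R : realType) :=
  Topological.copy (contfun R)
    (initial_topology
       (id : continuousType (R * R)%type R ->
             {family compact, (R * R)%type -> R})).

Lemma psi_subproof (R : realType) (z : R * R) :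
  continuous (fun w : R * R => dsup z w - dsup z 0).
Proof.
move=> w; apply: cvgB; last exact: cvg_cst.
apply: (@continuous_max _ _ (fun w : R * R => `|z.1 - w.1|)
  (fun w : R * R => `|z.2 - w.2|)).
- apply: (cvg_norm (f := fun w : R * R => z.1 - w.1)).
  by apply: cvgB; [exact: cvg_cst | exact: cvg_fst].
- apply: (cvg_norm (f := fun w : R * R => z.2 - w.2)).
  by apply: cvgB; [exact: cvg_cst | exact: cvg_snd].
Qed.

Definition psi {R : realType} (z : R * R) : contfun R :=
  mkcts (@psi_subproof R z).

Definition bordification (R : realType) : set (contfun R) :=
  closure (range psi).
Arguments bordification R : clear implicits.

(* Below, the set [bordification R] is used as a type, which carries the
   subspace topology: closures and neighborhoods of its subsets are relative
   to it. *)
Definition emb {R : realType} (z : R * R) : bordification R :=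
  exist _ (psi z) (mem_set (subset_closure (imageT psi z))).

Definition hboundary (R : realType) : set (bordification R) := ~` range emb.
Arguments hboundary R : clear implicits.

(* Distance to a set; [inf] has an arbitrary value on the empty set. *)
Definition dist_set {R : realType} (z : R * R) (W : set (R * R)) : R :=
  inf [set dsup z w | w in W].

Definition halfspace {R : realType} (W : set (R * R)) (C : R) : set (R * R) :=
  [set z | dist_set z W <= dsup z 0 + C].

(* [emb @^-1` V] is the trace of V on X; it is nonempty whenever V is open and
   nonempty, since X is dense in its bordification. *)
Definition star {R : realType} (xi : bordification R) :
    set (bordification R) :=
  closure (\bigcup_(C in [set C : R | 0 <= C])
    \bigcap_(V in open_nbhs xi) closure (emb @` halfspace (emb @^-1` V) C)).

Variant vdir := North | South.
Variant hdir := East | West.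

Section boundary_functions.
Variable R : realType.
Implicit Types (P : vdir) (Q : hdir) (m : {nonneg R}) (w : R * R).

Definition hV_fun P w : R :=
  match P with North => - w.2 | South => w.2 end.

Definition hH_fun Q w : R :=
  match Q with East => - w.1 | West => w.1 end.

(* The first letter of the superscript names the coordinate without shift:
   for instance h^NE_m (x, y) = max (- x - m) (- y). *)
Definition hVH_fun P Q m w : R := Num.max (hH_fun Q w - m%:num) (hV_fun P w).

Definition hHV_fun Q P m w : R := Num.max (hH_fun Q w) (hV_fun P w - m%:num).

Lemma hV_subproof P : continuous (hV_fun P).
Proof.
by case: P => w; rewrite /hV_fun; [apply: cvgN|]; exact: cvg_snd.
Qed.

Lemma hH_subproof Q : continuous (hH_fun Q).
Proof.
by case: Q => w; rewrite /hH_fun; [apply: cvgN|]; exact: cvg_fst.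
Qed.

Lemma hVH_subproof P Q m : continuous (hVH_fun P Q m).
Proof.
move=> w.
apply: (@continuous_max _ _ (fun w => hH_fun Q w - m%:num) (hV_fun P)).
- by apply: cvgB; [exact: hH_subproof | exact: cvg_cst].
- exact: hV_subproof.
Qed.

Lemma hHV_subproof Q P m : continuous (hHV_fun Q P m).
Proof.
move=> w.
apply: (@continuous_max _ _ (hH_fun Q) (fun w => hV_fun P w - m%:num)).
- exact: hH_subproof.
- by apply: cvgB; [exact: hV_subproof | exact: cvg_cst].
Qed.

Lemma bordification_mem (f : R * R -> R) (cf : continuous f) :
  (forall M : R, 0 <= M -> exists z : R * R, forall w,
     `|w.1| <= M -> `|w.2| <= M -> dsup z w - dsup z 0 = f w) ->
  (mkcts cf : contfun R) \in bordification R.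
Proof.
move=> Hf; apply/mem_set => B.
have /choice[u Hu] : forall n : nat, exists z : R * R, forall w,
    `|w.1| <= n%:R -> `|w.2| <= n%:R -> dsup z w - dsup z 0 = f w.
  by move=> n; exact: Hf.
have cvu : (fun n => (psi (u n) : R * R -> R)) @ \oo -->
    (f : {family compact, (R * R)%type -> R}).
  apply/fam_cvgP => A cA D /uniform_nbhs[E [entE ED]].
  have [M [_ HM]] := compact_bounded cA.
  suff : \forall n \near \oo, D (psi (u n) : R * R -> R) by [].
  near=> n; apply: ED => -[x y] /= Aw.
  have wn : `|((x, y) : R * R)| <= n%:R.
    apply: HM Aw; near: n; exact: nbhs_infty_gtr.
  move: wn; rewrite prod_normE ge_max => /andP[w1 w2].
  by rewrite /= /mkcts Hu //; exact: entourage_refl.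
case=> _ [[W oW <-] /= Wf] WB.
have : \forall n \near \oo, W (psi (u n) : R * R -> R).
  by apply: cvu; exact: open_nbhs_nbhs.
by case=> n _ /(_ n (leqnn n)) Wn; exists (psi (u n)); split; [exists (u n)|exact: WB].
Unshelve. all: by end_near. Qed.

Lemma emb_neq (h : bordification R) :
  (forall s : R, 0 <= s -> exists w, (set_val h : contfun R) w = - s) ->
  hboundary R h.
Proof.
move=> Hh [z _ zh].
have d0 : 0 <= dsup z 0 by rewrite /dsup le_max normr_ge0.
have [|w] := Hh (dsup z 0 + 1); first lra.
rewrite -zh /= /mkcts.
have : 0 <= dsup z w by rewrite /dsup le_max normr_ge0.
lra.
Qed.

(* The point of the quadrant (P, Q) at distance a (resp. b) from the vertical
   (resp. horizontal) axis. *)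
Let corner P Q (a b : R) : R * R :=
  (match Q with East => a | West => - a end,
   match P with North => b | South => - b end).

Let hH_corner P Q a b : hH_fun Q (corner P Q a b) = - a.
Proof. by case: Q; rewrite //= opprK. Qed.

Let hV_corner P Q a b : hV_fun P (corner P Q a b) = - b.
Proof. by case: P; rewrite //= opprK. Qed.

Let hH_le Q w a : `|w.1| <= a -> - a <= hH_fun Q w <= a.
Proof. by rewrite ler_norml; case: Q => /=; lra. Qed.

Let hV_le P w b : `|w.2| <= b -> - b <= hV_fun P w <= b.
Proof. by rewrite ler_norml; case: P => /=; lra. Qed.

Let dsup_corner P Q a b w : `|w.1| <= a -> `|w.2| <= b ->
  dsup (corner P Q a b) w = Num.max (a + hH_fun Q w) (b + hV_fun P w).
Proof.
move=> wa wb; rewrite /dsup; congr Num.max.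
- have := hH_le Q wa; case: Q => /= ?.
    by rewrite ger0_norm; lra.
  by rewrite ler0_norm; lra.
- have := hV_le P wb; case: P => /= ?.
    by rewrite ger0_norm; lra.
  by rewrite ler0_norm; lra.
Qed.

Let dsup_corner0 P Q a b : 0 <= a -> 0 <= b ->
  dsup (corner P Q a b) 0 = Num.max a b.
Proof.
by move=> a0 b0; rewrite dsup_corner ?normr0//; case: P; case: Q;
  rewrite /= ?oppr0 !addr0.
Qed.

Lemma hV_mem P : (mkcts (@hV_subproof P) : contfun R) \in bordification R.
Proof.
apply: bordification_mem => M M0; exists (corner P East M (3 * M)) => w wa wb.
have wb' : `|w.2| <= 3 * M by lra.
rewrite dsup_corner// dsup_corner0; [|lra..].
have := hH_le East wa; have := hV_le P wb => *.
by rewrite !max_r; lra.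
Qed.

Lemma hH_mem Q : (mkcts (@hH_subproof Q) : contfun R) \in bordification R.
Proof.
apply: bordification_mem => M M0; exists (corner North Q (3 * M) M) => w wa wb.
have wa' : `|w.1| <= 3 * M by lra.
rewrite dsup_corner// dsup_corner0; [|lra..].
have := hH_le Q wa; have := hV_le North wb => *.
by rewrite !max_l; lra.
Qed.

Lemma hVH_mem P Q m :
  (mkcts (@hVH_subproof P Q m) : contfun R) \in bordification R.
Proof.
have m0 : 0 <= m%:num by [].
apply: bordification_mem => M M0.
exists (corner P Q M (M + m%:num)) => w wa wb.
have wb' : `|w.2| <= M + m%:num by lra.
rewrite dsup_corner// dsup_corner0; [|lra..].
rewrite (@max_r _ _ M); last lra.
by rewrite /hVH_fun -[LHS]addrC addr_maxr; congr Num.max; lra.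
Qed.

Lemma hHV_mem Q P m :
  (mkcts (@hHV_subproof Q P m) : contfun R) \in bordification R.
Proof.
have m0 : 0 <= m%:num by [].
apply: bordification_mem => M M0.
exists (corner P Q (M + m%:num) M) => w wa wb.
have wa' : `|w.1| <= M + m%:num by lra.
rewrite dsup_corner// dsup_corner0; [|lra..].
rewrite (@max_l _ _ _ M); last lra.
by rewrite /hHV_fun -[LHS]addrC addr_maxr; congr Num.max; lra.
Qed.

Definition hV P : bordification R :=
  exist _ (mkcts (@hV_subproof P) : contfun R) (hV_mem P).

Definition hH Q : bordification R :=
  exist _ (mkcts (@hH_subproof Q) : contfun R) (hH_mem Q).

Definition hVH P Q m : bordification R :=
  exist _ (mkcts (@hVH_subproof P Q m) : contfun R) (hVH_mem P Q m).

Definition hHV Q P m : bordification R :=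
  exist _ (mkcts (@hHV_subproof Q P m) : contfun R) (hHV_mem Q P m).

Lemma hV_hboundary P : hboundary R (hV P).
Proof.
by apply: emb_neq => s _; exists (corner P East s s); exact: hV_corner.
Qed.

Lemma hH_hboundary Q : hboundary R (hH Q).
Proof.
by apply: emb_neq => s _; exists (corner North Q s s); exact: hH_corner.
Qed.

Lemma hVH_hboundary P Q m : hboundary R (hVH P Q m).
Proof.
apply: emb_neq => s _; exists (corner P Q s s); rewrite /= /mkcts /hVH_fun.
by rewrite hH_corner hV_corner max_r// gerBl.
Qed.

Lemma hHV_hboundary Q P m : hboundary R (hHV Q P m).
Proof.
apply: emb_neq => s _; exists (corner P Q s s); rewrite /= /mkcts /hHV_fun.
by rewrite hH_corner hV_corner max_l// gerBl.
Qed.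

Definition quadrant P Q : set (bordification R) :=
  [set hV P] `|` range (hVH P Q) `|` range (hHV Q P) `|` [set hH Q].

End boundary_functions.
Arguments hV {R} P.
Arguments hH {R} Q.
Arguments hVH {R} P Q m.
Arguments hHV {R} Q P m.
Arguments quadrant {R} P Q.

(* Main.v *)
Require Import Defs.
From mathcomp Require Import all_boot all_order all_algebra.
From mathcomp Require Import all_classical all_reals all_analysis.
From mathcomp Require Import lra.

Import Order.TTheory GRing.Theory Num.Theory.
Import numFieldNormedType.Exports.
Local Open Scope classical_set_scope.
Local Open Scope ring_scope.

(** Reduction to single points. A point z satisfies d(z, W) <= d(z, x_0) + C,
    up to enlarging C by 1, exactly when psi z w <= C for some w in W; since
    psi z is close to eta when emb z is, membership of eta in a star can be
    tested on the values of eta at points deep inside neighborhoods of xi.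

    Lower bound (mem_star): if every neighborhood of xi contains points w of
    the plane with eta w <= 0, then eta is in the star of xi, already with
    C = 1. Every function of quadrant P Q is <= 0 on the closed geometric
    quadrant (P, Q) (quadrant_le0), and points of that quadrant converge to
    each of the boundary points at stake, so this gives one inclusion.

    Upper bound (star_subset): fix C and a square of half-side K. If w lies
    deep in a neighborhood of xi and d(z, w) <= d(z, x_0) + C, then elementary
    plane geometry (inquad_axial, inquad_nonaxial) forces z so far out in an
    allowed quadrant that psi z coincides on the square with an element of the
    corresponding set quadrant P Q (emb_inquad). Hence the star lies in the
    closure of the union of the allowed quadrants. Quadrants are closed
    (closed_quadrant), which ends the proof.

    The difference between the two kinds of boundary points: being close to a
    nonaxial point of a quadrant forces both coordinates of w to be large of
    known signs (near_bent), whereas being close to an axial point only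
    confines w to a cone meeting two quadrants (near_axial), and z can then
    reach either of them.

    The four quadrants are treated at once through orient P Q, an isometric
    involution carrying the quadrant (P, Q) to the positive one. The nonaxial
    points of a quadrant form a single family bent c d with c, d >= 0 and
    c = 0 or d = 0. *)

(** * Uniform closeness on squares *)

Section topology.
Set Implicit Arguments.
Unset Strict Implicit.
Context {R : realType}.
Implicit Types (xi eta g : bordification R) (z w p : R * R) (M K e : R).

Definition horo xi : R * R -> R := (set_val xi : contfun R).

Lemma horo_emb z w : horo (emb z) w = dsup z w - dsup z 0.
Proof. by []. Qed.

Lemma horo_inj xi eta : horo xi =1 horo eta -> xi = eta.
Proof. by move=> xieta; apply/val_inj/continuousEP. Qed.

Definition square M : set (R * R) := [set w | `|w.1| <= M /\ `|w.2| <= M].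

Definition square_ball xi M e : set (bordification R) :=
  [set g | forall w, square M w -> `|horo xi w - horo g w| < e].

Lemma compact_square M : compact (square M).
Proof.
have -> : square M = `[-M, M]%classic `*` `[-M, M]%classic.
  by apply/seteqP; split => -[x y]; rewrite /square /= !in_itv /= -!ler_norml.
by apply: compact_setX; exact: segment_compact.
Qed.

(** Squares are compact and every compact set lies in one of them, so uniform
    closeness on squares describes the topology of the bordification: this
    lemma is one half of that fact, [square_ball_basis] the other. *)
Lemma nbhs_square_ball xi M e : 0 < e -> nbhs xi (square_ball xi M e).
Proof.
move=> e0.
pose f : {family compact, (R * R)%type -> R} := horo xi.
have Nf : nbhs f [set h : {family compact, (R * R)%type -> R} |
    forall y, square M y -> ball (horo xi y) e (h y)].
  apply: (@fam_nbhs _ R compact _ [set xy | ball xy.1 e xy.2]).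
    exact: (@entourage_ball _ _ (PosNum e0)).
  exact: compact_square.
have c1 : continuous (horo : bordification R ->
    {family compact, (R * R)%type -> R}).
  move=> g; apply: (@continuous_comp (bordification R) (contfun R)
     {family compact, (R * R)%type -> R} set_val id).
    exact: initial_continuous.
  exact: initial_continuous.
exact: (c1 xi _ Nf).
Qed.

Lemma square_ball_basis xi (V : set (bordification R)) : nbhs xi V ->
  exists M e, [/\ 0 <= M, 0 < e & square_ball xi M e `<=` V].
Proof.
move=> NV.
(* The filter generated by the square balls converges uniformly on compact
   sets, hence contains every neighborhood. *)
pose F : set_system (R * R -> R) :=
  filter_from [set Me : R * R | 0 <= Me.1 /\ 0 < Me.2]
  (fun Me => [set h | forall w, square Me.1 w -> `|horo xi w - h w| < Me.2]).
have FF : Filter F.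
  apply: filter_from_filter; first by exists (0, 1); split => /=.
  move=> [M e] [M' e'] [/= M0 e0] [/= M'0 e'0].
  exists (Num.max M M', Num.min e e') => /=.
    by rewrite le_max M0 lt_min e0 e'0.
  move=> h H; split=> w [w1 w2].
    have := H w _; rewrite lt_min => /(_ _)/andP[]//.
    by split; rewrite le_max ?w1 ?w2.
  have := H w _; rewrite lt_min => /(_ _)/andP[]//.
  by split; rewrite le_max ?w1 ?w2 orbT.
have cvF : F --> (horo xi : {family compact, (R * R)%type -> R}).
  apply/fam_cvgP => A cA D /uniform_nbhs[E [entE ED]].
  have [M [_ HM]] := compact_bounded cA.
  move: entE; rewrite -entourage_from_ballE => -[e /= e0 eE].
  have M1 : M < `|M| + 1 by have := ler_norm M; lra.
  exists (`|M| + 1, e) => /=; first by split=> //; have := normr_ge0 M; lra.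
  move=> h Hh; apply: ED => -[x y] /= Axy; apply: eE => /=.
  apply: Hh; have := HM _ M1 _ Axy.
  by rewrite /= prod_normE ge_max => /andP.
case: NV => _ [[W oW <-] /= Wf] WV.
case: oW => W' oW' W'W; rewrite -W'W /= in Wf WV.
have [[M e] [/= M0 e0] H] : F W' by apply: cvF; exact: open_nbhs_nbhs.
exists M, e; split=> // g gM; apply: WV; exact: H gM.
Qed.

End topology.

(** * Two criteria for stars *)

Section stars.
Set Implicit Arguments.
Unset Strict Implicit.
Context {R : realType}.
Implicit Types (xi eta : bordification R) (z w p : R * R) (C K : R).

Lemma emb_dense eta (U : set (bordification R)) :
  nbhs eta U -> exists z, U (emb z).
Proof.
case=> _ [[W oW <-] /= Weta] WU.
have [_ [[z _ <-] Wz]] : (range psi `&` W) !=set0.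
  by apply: (set_valP eta); exact: open_nbhs_nbhs.
by exists z; exact: WU.
Qed.

(** Once w is fixed in V, any z close enough to eta on a square containing w
    has d(z, w) - d(z, 0) < eta w + 1 <= 1, so z is in the halfspace H(V, 1). *)
Lemma mem_star xi eta :
  (forall V, nbhs xi V -> exists w, V (emb w) /\ horo eta w <= 0) ->
  star xi eta.
Proof.
move=> deep; apply: subset_closure; exists 1 => //= V oV U NU.
have [w [Vw etaw]] := deep _ (open_nbhs_nbhs oV).
have NB := nbhs_square_ball eta (`|w.1| + `|w.2|) ltr01.
have [z [Uz Bz]] := emb_dense (filterI NU NB).
exists (emb z); split=> //; exists z => //.
have : `|horo eta w - horo (emb z) w| < 1 by apply: Bz; split; rewrite (lerDl, lerDr).
rewrite horo_emb ltr_norml => /andP[H _].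
rewrite /halfspace /= (le_trans (y := dsup z w)) //; last lra.
apply: ge_inf; last by exists w.
by exists 0 => _ [v _ <-]; rewrite /dsup le_max normr_ge0.
Qed.

(** The infimum in d(z, V) need not be attained, so membership in H(V, C) only
    yields a w in V with d(z, w) <= d(z, 0) + C + 1; quantifying over all C
    absorbs the loss. As A is closed, agreement with members of A on larger
    and larger squares is enough. *)
Lemma star_subset xi (A : set (bordification R)) : closed A ->
  (forall C K, 0 <= C -> 0 <= K -> exists V, nbhs xi V /\
     forall z w, V (emb w) -> dsup z w <= dsup z 0 + C ->
     exists2 q, A q & {in square K, horo q =1 horo (emb z)}) ->
  star xi `<=` A.
Proof.
move=> cA near_A; rewrite [X in _ `<=` X](closure_id _).1 //.
rewrite [X in _ `<=` X](closure_id _).1; last exact: closed_closure.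
apply: closure_subset => eta [C /= C0 etaC] U /square_ball_basis[K [e [K0 e0 BU]]].
have [V [NV HV]] := near_A _ _ (addr_ge0 C0 ler01) K0.
(* Stars only test open neighborhoods. *)
have oV : open_nbhs xi (interior V).
  by rewrite open_nbhsE; split; [exact: open_interior|exact: nbhs_interior].
have [_ [[z zV <-] Bz]] := etaC _ oV _ (nbhs_square_ball eta K e0).
have [w0 Vw0] := emb_dense (open_nbhs_nbhs oV).
have [||_ [w Vw <-] zw] := @inf_lt _ [set dsup z w | w in emb @^-1` (interior V)]
    (dsup z 0 + (C + 1)).
- by exists (dsup z w0), w0.
- by apply: le_lt_trans zV _; lra.
have [q Aq qz] := HV z w (interior_subset Vw) (ltW zw).
exists q; split=> //; apply: BU => p Kp.
by rewrite qz ?inE//; exact: Bz.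
Qed.

End stars.

(** * Elementary inequalities in the plane *)

(** Reduces piecewise linear inequalities to linear ones by splitting on the
    signs under absolute values and on the order of the arguments of max. *)
Ltac split_norm_max :=
  repeat match goal with
  | |- context [Num.norm ?x] => case: (ger0P x) => ?
  end;
  repeat match goal with
  | |- context [Num.max ?x ?y] => case: (lerP x y) => ?
  end.

Section plane.
Set Implicit Arguments.
Unset Strict Implicit.
Context {R : realType}.
Implicit Types (a b c d e h x y B K M C : R).

(** The three regimes in which psi (a, b) already equals, on the square of
    half-side K, an element of the quadrant: deep in the interior (nonaxial),
    or deep in a cone around one of the two bounding half-axes (axial). *)
Definition inquad K a b : bool :=
  [|| (K <= a) && (K <= b), `|a| + 2 * K <= b | `|b| + 2 * K <= a].

Lemma inquadC K a b : inquad K a b = inquad K b a.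
Proof. by rewrite /inquad andbC; congr (_ || _); rewrite orbC. Qed.

(** If max(|x|, |y|) were attained at a negative coordinate, the distance to
    (a, b) would exceed it by a or b, hence by more than C. So it is attained
    by, say, y >= 0, and then a - x <= y + C leaves only interior or near-axis
    positions. The constant 6: as y is also at least half of b - C, it exceeds
    3 K, hence exceeds |x| + 2 K when |x| < K. *)
Lemma inquad_nonaxial x y a b C K : 0 <= K -> 0 <= C ->
  C + 6 * K < a -> C + 6 * K < b ->
  Num.max `|x - a| `|y - b| <= Num.max `|x| `|y| + C ->
  inquad K x y.
Proof.
move=> K0 C0 aM bM.
rewrite ge_max !ler_norml => /andP[].
rewrite /inquad; split_norm_max; lra.
Qed.

(** Here the sign of x is free, as (a, b) is only known to lie in the cone
    |a| < b, which meets two quadrants. *)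
Lemma inquad_axial x y a b C K : 0 <= K -> 0 <= C ->
  `|a| + C + 6 * K < b ->
  Num.max `|x - a| `|y - b| <= Num.max `|x| `|y| + C ->
  inquad K x y || inquad K (- x) y.
Proof.
move=> K0 C0 aM; rewrite ge_max !ler_norml => /andP[].
move: aM; rewrite /inquad normrN; split_norm_max; lra.
Qed.

(** A single test point suffices to locate a point (a, b) close to an axial
    function: on (0, M) the latter takes the value - M. *)
Lemma near_axial a b M : 1 <= M ->
  Num.max `|a| `|b - M| < Num.max `|a| `|b| - M + 1 -> `|a| + M - 1 < b.
Proof. by move=> M1; split_norm_max; lra. Qed.

(** Three test points locate a point (a, b) close to a nonaxial function: the
    value - M at (M, M) forces max(|a|, |b|) to be large, and the values 1 at
    (- 1 - c, 0) and (0, - 1 - d) force both coordinates to be positive and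
    comparable with that maximum. *)
Lemma near_bent a b c d M : 0 <= c -> 0 <= d ->
  c + d + 2 < M ->
  Num.max `|a - M| `|b - M| < Num.max `|a| `|b| - M + 1 ->
  Num.max `|a| `|b| < Num.max `|a + (1 + c)| `|b| ->
  Num.max `|a| `|b| < Num.max `|a| `|b + (1 + d)| ->
  M - c - d - 2 < a /\ M - c - d - 2 < b.
Proof.
move=> c0 d0 ?.
rewrite gt_max ![_ < Num.max _ _]lt_max !gt_max !ltxx !andbF !andFb ?orFb ?orbF.
rewrite !ltr_norml; split_norm_max; lra.
Qed.

(** Evaluating on the half-axes recovers the parameters of a nonaxial
    function, once they are bounded by B. *)
Lemma bent_at_axis B c d : 0 <= c -> 0 <= d -> c = 0 \/ d = 0 -> c <= B ->
  Num.max (- 0 - c) (- B - d) = - c.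
Proof. by move=> c0 d0 cd cB; rewrite oppr0 sub0r max_l //; case: cd; lra. Qed.

Lemma bent_close h x y c d c' d' e :
  `|h - Num.max (- x - c) (- y - d)| < e ->
  `|c - c'| < e -> `|d - d'| < e ->
  `|h - Num.max (- x - c') (- y - d')| < 2 * e.
Proof. by rewrite !ltr_norml; split_norm_max; lra. Qed.

End plane.

(** * Quadrants of the horofunction boundary *)

Section quadrants.
Set Implicit Arguments.
Unset Strict Implicit.
Context {R : realType}.
Variables (P : vdir) (Q : hdir).
Implicit Types (q eta : bordification R) (z w p : R * R) (a b c d K M : R).

(** Coordinates in which the quadrant (P, Q) is the positive one; up to the
    sign these are the two axial functions of the quadrant. *)
Definition orient z : R * R := (- hH_fun Q z, - hV_fun P z).

(** Common form of the two nonaxial families: h^PQ_m is [bent m 0] and h^QP_m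
    is [bent 0 m]. *)
Definition bent c d p : R :=
  Num.max (- (orient p).1 - c) (- (orient p).2 - d).

Lemma orientK : involutive orient.
Proof. by move=> [x y]; rewrite /orient; case: P; case: Q; rewrite /= ?opprK. Qed.

Lemma square_orient M z : square M (orient z) <-> square M z.
Proof. by rewrite /square /orient; case: P; case: Q; rewrite /= ?opprK ?normrN. Qed.

Lemma dsup_orient z w : dsup (orient z) (orient w) = dsup z w.
Proof.
rewrite /dsup /orient /=; congr Num.max.
  by case: Q => /=; [rewrite !opprK|rewrite opprK addrC distrC].
by case: P => /=; [rewrite !opprK|rewrite opprK addrC distrC].
Qed.

Lemma orient0 : orient 0 = 0.
Proof. by rewrite /orient; case: P; case: Q; rewrite /= ?opprK ?oppr0. Qed.

Lemma horo_emb_orient z p : horo (emb z) p =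
  Num.max `|(orient z).1 - (orient p).1| `|(orient z).2 - (orient p).2|
  - Num.max `|(orient z).1| `|(orient z).2|.
Proof. by rewrite horo_emb -dsup_orient -(dsup_orient z) orient0 /dsup !subr0. Qed.

Lemma horo_hV p : horo (hV P) p = - (orient p).2.
Proof. by rewrite opprK. Qed.

Lemma horo_hH p : horo (hH Q) p = - (orient p).1.
Proof. by rewrite opprK. Qed.

Lemma horo_hVH (m : {nonneg R}) : horo (hVH P Q m) =1 bent m%:num 0.
Proof. by move=> p; rewrite /bent !opprK subr0. Qed.

Lemma horo_hHV (m : {nonneg R}) : horo (hHV Q P m) =1 bent 0 m%:num.
Proof. by move=> p; rewrite /bent !opprK subr0. Qed.

Lemma quadrantP q : quadrant P Q q <->
  [\/ horo q =1 horo (hV P), horo q =1 horo (hH Q)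
    | exists c d, [/\ 0 <= c, 0 <= d, c = 0 \/ d = 0 & horo q =1 bent c d]].
Proof.
split.
  case=> [[[->|[m _ <-]]|[m _ <-]]|->]; [by constructor 1| | |by constructor 2].
    by constructor 3; exists m%:num, 0; split=> //; [right|exact: horo_hVH].
  by constructor 3; exists 0, m%:num; split=> //; [left|exact: horo_hHV].
case=> [/horo_inj->|/horo_inj->|[c [d [c0 d0 [cE|dE] qE]]]].
- by left; left; left.
- by right.
- left; right; exists (NngNum d0) => //; apply: horo_inj => p.
  by rewrite horo_hHV qE cE.
- left; left; right; exists (NngNum c0) => //; apply: horo_inj => p.
  by rewrite horo_hVH qE dE.
Qed.

Lemma square_orient_ineq K p : square K p ->
  [/\ - K <= (orient p).1, (orient p).1 <= K,
      - K <= (orient p).2 & (orient p).2 <= K].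
Proof.
move=> /square_orient[]; rewrite !ler_norml.
by move=> /andP[? ?] /andP[? ?].
Qed.

(** Beyond the square in both directions, the absolute values in the sup
    distance open with a constant sign. *)
Lemma emb_diagonal z K : K <= (orient z).1 -> K <= (orient z).2 ->
  {in square K, horo (emb z) =1
     bent (Num.max (orient z).1 (orient z).2 - (orient z).1)
          (Num.max (orient z).1 (orient z).2 - (orient z).2)}.
Proof.
move=> Ka Kb p /set_mem/square_orient_ineq[].
rewrite horo_emb_orient /bent.
move: (orient p) (orient z) Ka Kb => [x y] [a b] /= Ka Kb px xp py yp.
by rewrite !ger0_norm; [split_norm_max; lra|lra..].
Qed.

(** Inside this cone the second coordinate realizes the distance to every
    point of the square. *)
Lemma emb_vertical z K : `|(orient z).1| + 2 * K <= (orient z).2 ->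
  {in square K, horo (emb z) =1 horo (hV P)}.
Proof.
move=> Kz p /set_mem/square_orient_ineq[].
rewrite horo_emb_orient horo_hV.
move: (orient p) (orient z) Kz => [x y] [a b] /= Kab px xp py yp.
have a0 := normr_ge0 a; have := ler_norm a; have := ler_norm (- a).
rewrite normrN => aa aa'.
have b_ge0 : 0 <= b by lra.
have by_ge0 : 0 <= b - y by lra.
by rewrite (ger0_norm b_ge0) (ger0_norm by_ge0) !max_r ?ler_norml; lra.
Qed.

Lemma emb_horizontal z K : `|(orient z).2| + 2 * K <= (orient z).1 ->
  {in square K, horo (emb z) =1 horo (hH Q)}.
Proof.
move=> Kz p /set_mem/square_orient_ineq[].
rewrite horo_emb_orient horo_hH.
move: (orient p) (orient z) Kz => [x y] [a b] /= Kba px xp py yp.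
have b0 := normr_ge0 b; have := ler_norm b; have := ler_norm (- b).
rewrite normrN => bb bb'.
have a_ge0 : 0 <= a by lra.
have ax_ge0 : 0 <= a - x by lra.
by rewrite (ger0_norm a_ge0) (ger0_norm ax_ge0) !max_l ?ler_norml; lra.
Qed.

Lemma emb_inquad z K : inquad K (orient z).1 (orient z).2 ->
  exists2 q, quadrant P Q q & {in square K, horo q =1 horo (emb z)}.
Proof.
move=> /or3P[/andP[Ka Kb]|Kz|Kz].
- set m := Num.max (orient z).1 (orient z).2.
  have zE := emb_diagonal Ka Kb; rewrite -/m in zE.
  have [ab|ba] := leP (orient z).1 (orient z).2.
  + have c0 : 0 <= m - (orient z).1 by rewrite subr_ge0 le_max lexx.
    exists (hVH P Q (NngNum c0)); first by left; left; right; exists (NngNum c0).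
    move=> p Kp; rewrite horo_hVH zE //=.
    by have -> : m - (orient z).2 = 0 by rewrite /m max_r ?subrr.
  + have d0 : 0 <= m - (orient z).2 by rewrite subr_ge0 le_max lexx orbT.
    exists (hHV Q P (NngNum d0)); first by left; right; exists (NngNum d0).
    move=> p Kp; rewrite horo_hHV zE //=.
    by have -> : m - (orient z).1 = 0 by rewrite /m max_l ?subrr // ltW.
- by exists (hV P); [left; left; left|move=> p Kp; rewrite (emb_vertical Kz)].
- by exists (hH Q); [right|move=> p Kp; rewrite (emb_horizontal Kz)].
Qed.

Lemma quadrant_le0 q p : 0 <= (orient p).1 -> 0 <= (orient p).2 ->
  quadrant P Q q -> horo q p <= 0.
Proof.
move=> a0 b0 /quadrantP[->|->|[c [d [c0 d0 _ ->]]]].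
- by rewrite horo_hV oppr_le0.
- by rewrite horo_hH oppr_le0.
- by rewrite /bent; split_norm_max; lra.
Qed.

(** A quadrant is a compactified line, h^P and h^Q being the ends of the
    nonaxial family. A limit eta which is neither end differs from them at two
    points p1 and p2, so that its approximants have parameters bounded by some
    B; the parameters are then continuous, as they are read off from values on
    the half-axes, and they pass to the limit. *)
Lemma closed_quadrant : closed (quadrant P Q : set (bordification R)).
Proof.
move=> eta eta_cl; apply/quadrantP.
have [|/existsNP[p1 neV]] := pselect (horo eta =1 horo (hV P)).
  by constructor 1.
have [|/existsNP[p2 neH]] := pselect (horo eta =1 horo (hH Q)).
  by constructor 2.
constructor 3.
pose B := `|(orient p1).1| + `|(orient p1).2| + `|(orient p2).1| + `|(orient p2).2|.
have [n1 n2] : 0 <= `|(orient p1).1| /\ 0 <= `|(orient p1).2| by [].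
have [n3 n4] : 0 <= `|(orient p2).1| /\ 0 <= `|(orient p2).2| by [].
have B0 : 0 <= B by rewrite !addr_ge0.
(* Within e0 of eta at p1 and p2, a function is neither h^P nor h^Q. *)
pose e0 := Num.min `|horo eta p1 - horo (hV P) p1|
                   `|horo eta p2 - horo (hH Q) p2|.
have e0_gt0 : 0 < e0.
  by rewrite lt_min !normr_gt0 !subr_eq0; apply/andP; split; exact/eqP.
have approx p e : 0 < e -> exists c d,
    [/\ 0 <= c, 0 <= d & c = 0 \/ d = 0] /\
    [/\ `|horo eta p - bent c d p| < e, `|horo eta (orient (0, B)) + c| < e
      & `|horo eta (orient (B, 0)) + d| < e].
  move=> e_gt0.
  have m_gt0 : 0 < Num.min e e0 by rewrite lt_min e_gt0.
  have [q [Qq Bq]] :=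
    eta_cl _ (nbhs_square_ball eta (B + `|p.1| + `|p.2|) m_gt0).
  have sq w : `|(orient w).1| <= B -> `|(orient w).2| <= B ->
      square (B + `|p.1| + `|p.2|) w.
    move=> w1 w2; apply/square_orient; have := normr_ge0 p.1.
    by have := normr_ge0 p.2; split; lra.
  have Bp1 : `|horo eta p1 - horo q p1| < e0.
    have /Bq : square (B + `|p.1| + `|p.2|) p1 by apply: sq; rewrite /B; lra.
    by rewrite lt_min => /andP[].
  have Bp2 : `|horo eta p2 - horo q p2| < e0.
    have /Bq : square (B + `|p.1| + `|p.2|) p2 by apply: sq; rewrite /B; lra.
    by rewrite lt_min => /andP[].
  move: Qq => /quadrantP[qE|qE|[c [d [c0 d0 cd qE]]]].
  - by move: Bp1; rewrite qE lt_min ltxx.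
  - by move: Bp2; rewrite qE lt_min ltxx andbF.
  (* For c > B the bent function takes the value of h^P at p1. *)
  have cB : c <= B.
    rewrite leNgt; apply/negP => Bc; move: Bp1.
    suff -> : horo q p1 = horo (hV P) p1 by rewrite lt_min ltxx.
    have d00 : d = 0 by case: cd => // ?; lra.
    rewrite qE horo_hV /bent d00 subr0 max_r //; move: Bc; rewrite /B.
    have := ler_norm (- (orient p1).1); have := ler_norm (orient p1).2.
    by rewrite (normrN (orient p1).1); lra.
  have dB : d <= B.
    rewrite leNgt; apply/negP => Bd; move: Bp2.
    suff -> : horo q p2 = horo (hH Q) p2 by rewrite lt_min ltxx andbF.
    have c00 : c = 0 by case: cd => // ?; lra.
    rewrite qE horo_hH /bent c00 subr0 max_l //; move: Bd; rewrite /B.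
    have := ler_norm (orient p2).1; have := ler_norm (- (orient p2).2).
    by rewrite (normrN (orient p2).2); lra.
  exists c, d; split=> //; split.
  - have /Bq : square (B + `|p.1| + `|p.2|) p.
      by have := normr_ge0 p.1; have := normr_ge0 p.2; split; lra.
    by rewrite qE lt_min => /andP[].
  - have /Bq : square (B + `|p.1| + `|p.2|) (orient (0, B)).
      by apply: sq; rewrite orientK /= ?normr0 ?ger0_norm.
    rewrite qE lt_min /bent orientK /=.
    rewrite bent_at_axis //.
    by rewrite opprK => /andP[].
  - have /Bq : square (B + `|p.1| + `|p.2|) (orient (B, 0)).
      by apply: sq; rewrite orientK /= ?normr0 ?ger0_norm.
    rewrite qE lt_min /bent orientK /=.
    rewrite maxC bent_at_axis //; last by case: cd; [right|left].
    by rewrite opprK => /andP[].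
exists (- horo eta (orient (0, B))), (- horo eta (orient (B, 0))).
move: (horo eta (orient (0, B))) (horo eta (orient (B, 0))) approx => c d approx.
have c_le0 : c <= 0.
  rewrite leNgt; apply/negP => /(approx 0)[c' [d' [[c0 d0 cd] [_ + _]]]].
  by rewrite ltr_norml; lra.
have d_le0 : d <= 0.
  rewrite leNgt; apply/negP => /(approx 0)[c' [d' [[c0 d0 cd] [_ _]]]].
  by rewrite ltr_norml; lra.
split; [lra|lra| |].
(* An approximant within min(|c|, |d|) still has a vanishing parameter, which
   is absurd if neither c nor d vanishes. *)
- have [->|c_neq0] := eqVneq c 0; first by left; rewrite oppr0.
  have [->|d_neq0] := eqVneq d 0; first by right; rewrite oppr0.
  have m_gt0 : 0 < Num.min (- c) (- d).
    by rewrite lt_min !oppr_gt0 !lt_neqAle c_neq0 d_neq0 c_le0.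
  have [c' [d' [[c0 d0 cd] [_]]]] := approx 0 _ m_gt0.
  by rewrite !lt_min !ltr_norml; case: cd; lra.
- move=> p; apply/eqP; rewrite -subr_eq0 -normr_le0 leNgt; apply/negP => gap.
  have g2 : 0 < `|horo eta p - bent (- c) (- d) p| / 2 by rewrite divr_gt0.
  have [c' [d' [_ [hp hc hd]]]] := approx p _ g2.
  rewrite [_ + c']addrC -[c in _ + c]opprK in hc.
  rewrite [_ + d']addrC -[d in _ + d]opprK in hd.
  by have := bent_close hp hc hd; rewrite -/(bent _ _ _); lra.
Qed.

End quadrants.

(** * The stars of the boundary points *)

Section star_computations.
Set Implicit Arguments.
Unset Strict Implicit.
Context {R : realType}.
Implicit Types (P : vdir) (Q : hdir) (xi eta : bordification R) (z w p : R * R).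
Implicit Types (c d C K M : R).

(** Far out in the plane, psi coincides on squares with the boundary functions
    of the quadrants; this turns such coincidences into membership in U. *)
Lemma nbhs_agree xi (U : set (bordification R)) : nbhs xi U ->
  exists2 M, 0 <= M &
    forall w, {in square M, horo (emb w) =1 horo xi} -> U (emb w).
Proof.
move=> /square_ball_basis[M [e [M0 e0 BU]]]; exists M => // w wxi.
by apply: BU => p Mp; rewrite wxi ?inE// subrr normr0.
Qed.

(** The test points p are given in oriented coordinates. *)
Lemma square_ball_orient P Q xi M w p : square_ball xi M 1 (emb w) ->
  square M p ->
  horo xi (orient P Q p) - 1
    < Num.max `|(orient P Q w).1 - p.1| `|(orient P Q w).2 - p.2|
      - Num.max `|(orient P Q w).1| `|(orient P Q w).2|
    < horo xi (orient P Q p) + 1.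
Proof.
move=> Bw Mp; have /Bw : square M (orient P Q p) by apply/square_orient.
rewrite (horo_emb_orient P Q) orientK ltr_norml => /andP[? ?].
by apply/andP; split; lra.
Qed.

Lemma halfspace_orient P Q z w C : dsup z w <= dsup z 0 + C ->
  Num.max `|(orient P Q z).1 - (orient P Q w).1|
          `|(orient P Q z).2 - (orient P Q w).2|
  <= Num.max `|(orient P Q z).1| `|(orient P Q z).2| + C.
Proof.
rewrite -(dsup_orient P Q z w) -(dsup_orient P Q z 0) orient0.
by rewrite {2}/dsup /= !subr0.
Qed.

(** Points near h^P are deep in the cone around the P half-axis, with no
    control on the sign of the other coordinate; hence both quadrants. *)
Lemma star_hV_subset P :
  star (hV P : bordification R) `<=` quadrant P East `|` quadrant P West.
Proof.
apply: star_subset; first by apply: closedU; exact: closed_quadrant.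
(* [near_axial] loses the radius 1 of the ball. *)
move=> C K C0 K0; pose M := C + 6 * K + 1.
exists (square_ball (hV P) M 1); split; first exact: nbhs_square_ball.
move=> z w Bw /(halfspace_orient P East) zw.
have Mp : square M (0, M) by split; rewrite /= ?normr0 ?ger0_norm /M; lra.
have := square_ball_orient P East Bw Mp.
rewrite (horo_hV P East) orientK [(0, M).1]/= [(0, M).2]/= subr0.
move=> /andP[_ wM].
have wdeep : `|(orient P East w).1| + M - 1 < (orient P East w).2.
  by apply: near_axial; first rewrite /M; lra.
have wdeepC : `|(orient P East w).1| + C + 6 * K < (orient P East w).2.
  by move: wdeep; rewrite /M; lra.
have /orP[] := inquad_axial K0 C0 wdeepC zw.
  by case/emb_inquad => q Qq qz; exists q => //; left.
have -> : - (orient P East z).1 = (orient P West z).1 by rewrite /= opprK.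
by case/(@emb_inquad _ P West) => q Qq qz; exists q => //; right.
Qed.

Lemma star_hH_subset Q :
  star (hH Q : bordification R) `<=` quadrant North Q `|` quadrant South Q.
Proof.
apply: star_subset; first by apply: closedU; exact: closed_quadrant.
move=> C K C0 K0; pose M := C + 6 * K + 1.
exists (square_ball (hH Q) M 1); split; first exact: nbhs_square_ball.
move=> z w Bw /(halfspace_orient North Q) zw.
have Mp : square M (M, 0) by split; rewrite /= ?normr0 ?ger0_norm /M; lra.
have := square_ball_orient North Q Bw Mp.
rewrite (horo_hH North Q) orientK [(M, 0).1]/= [(M, 0).2]/= subr0.
rewrite (maxC `|(orient North Q w).1 - M|) (maxC `|(orient North Q w).1|).
move=> /andP[_ wM].
have wdeep : `|(orient North Q w).2| + M - 1 < (orient North Q w).1.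
  by apply: near_axial; first rewrite /M; lra.
have wdeepC : `|(orient North Q w).2| + C + 6 * K < (orient North Q w).1.
  by move: wdeep; rewrite /M; lra.
rewrite maxC [X in _ <= X + _]maxC in zw.
have /orP[] := inquad_axial K0 C0 wdeepC zw; rewrite inquadC.
  by case/emb_inquad => q Qq qz; exists q => //; left.
have -> : - (orient North Q z).2 = (orient South Q z).2 by rewrite /= opprK.
by case/(@emb_inquad _ South Q) => q Qq qz; exists q => //; right.
Qed.

Lemma star_bent P Q xi c d : 0 <= c -> 0 <= d -> c = 0 \/ d = 0 ->
  horo xi =1 bent P Q c d -> star xi = quadrant P Q.
Proof.
move=> c0 d0 cd xiE; apply/seteqP; split.
  apply: star_subset; first exact: closed_quadrant.
  (* [near_bent] loses c + d + 2 from M, which has to be larger than that. *)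
  move=> C K C0 K0; pose M := C + 6 * K + c + d + 3.
  exists (square_ball xi M 1); split; first exact: nbhs_square_ball.
  move=> z w Bw /(halfspace_orient P Q) zw; apply: emb_inquad.
  have inM x y : - M <= x <= M -> - M <= y <= M -> square M (x, y).
    by rewrite -!ler_norml.
  have /(square_ball_orient P Q Bw) : square M (M, M).
    by apply: inM; rewrite /M; lra.
  have /(square_ball_orient P Q Bw) : square M (- (1 + c), 0).
    by apply: inM; rewrite /M; lra.
  have /(square_ball_orient P Q Bw) : square M (0, - (1 + d)).
    by apply: inM; rewrite /M; lra.
  rewrite !xiE /bent !orientK ![(_, _).1]/= ![(_, _).2]/= !opprK !subr0.
  have -> : Num.max (- 0 - c) (1 + d - d) = 1 by rewrite max_r; lra.
  have -> : Num.max (1 + c - c) (- 0 - d) = 1 by rewrite max_l; lra.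
  have -> : Num.max (- M - c) (- M - d) = - M.
    by case: cd => ->; rewrite subr0; [rewrite max_l|rewrite max_r]; lra.
  move=> /andP[wd _] /andP[wc _] /andP[_ wM].
  have [] := @near_bent _ (orient P Q w).1 (orient P Q w).2 c d M c0 d0.
  - by rewrite /M; lra.
  - by lra.
  - by lra.
  - by lra.
  move=> aM bM; apply: (inquad_nonaxial K0 C0 _ _ zw).
  - by move: aM; rewrite /M; lra.
  - by move: bM; rewrite /M; lra.
move=> eta Qeta; apply: mem_star => V /nbhs_agree[M M0 MV].
(* As c or d vanishes, the maximum of the coordinates is M + c + d, so that
   this point has parameters c and d in [emb_diagonal]. *)
exists (orient P Q (M + d, M + c)); split.
  apply: MV => p Mp.
  rewrite (@emb_diagonal _ P Q _ M) ?orientK /=; [|lra|lra|by []].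
  rewrite xiE; congr bent.
    by case: cd => ->; [rewrite max_l|rewrite max_r]; lra.
  by case: cd => ->; [rewrite max_l|rewrite max_r]; lra.
by apply: (quadrant_le0 _ _ Qeta); rewrite orientK /=; lra.
Qed.

Lemma quadrant_star_hV P Q : quadrant P Q `<=` star (hV P : bordification R).
Proof.
move=> eta Qeta; apply: mem_star => V /nbhs_agree[M M0 MV].
exists (orient P Q (0, 2 * M)); split.
  by apply: MV; apply: (@emb_vertical _ P Q); rewrite orientK /= normr0 add0r.
by apply: (quadrant_le0 _ _ Qeta); rewrite orientK /=; lra.
Qed.

Lemma quadrant_star_hH P Q : quadrant P Q `<=` star (hH Q : bordification R).
Proof.
move=> eta Qeta; apply: mem_star => V /nbhs_agree[M M0 MV].
exists (orient P Q (2 * M, 0)); split.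
  by apply: MV; apply: (@emb_horizontal _ P Q); rewrite orientK /= normr0 add0r.
by apply: (quadrant_le0 _ _ Qeta); rewrite orientK /=; lra.
Qed.

End star_computations.

Theorem theoremE (R : realType) :
  [/\ forall P : vdir,
        star (hV P : bordification R) = quadrant P East `|` quadrant P West,
      forall Q : hdir,
        star (hH Q : bordification R) = quadrant North Q `|` quadrant South Q,
      forall (P : vdir) (Q : hdir) (m : {nonneg R}),
        star (hVH P Q m) = quadrant P Q
    & forall (P : vdir) (Q : hdir) (m : {nonneg R}),
        star (hHV Q P m) = quadrant P Q].
Proof.
split=> [P|Q|P Q m|P Q m].
- apply/seteqP; split; first exact: star_hV_subset.
  by move=> eta []; exact: quadrant_star_hV.
- apply/seteqP; split; first exact: star_hH_subset.
  by move=> eta []; exact: quadrant_star_hH.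
- by apply: (star_bent _ _ _ (@horo_hVH _ P Q m)) => //; right.
- by apply: (star_bent _ _ _ (@horo_hHV _ P Q m)) => //; left.
Qed.
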